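(* Let $k:[0,\infty)\to[0,\infty)$ be a measurable function such that for all $\delta>0$ $$\int_0^\delta r^{d-1}k(r)\,dr=\infty .$$ Suppose that $V:\mathbb{R}^d\to\mathbb{R}$ is a measurable function such that $$\int_{\mathbb{R}^d}\int_{\mathbb{R}^d}|V(x)||V(y)|k(|x-y|)\,dx\,dy<\infty .$$ Then for any choice of $\varepsilon,r>0$ and $x\in\mathbb{R}^d$ it is not the case that $|V(y)|>\varepsilon$ for a.e. $y\in B_r(x)$. In particular, if $V$ is continuous, then $V\equiv0$.
   Context: $d\in\mathbb{N}$, and $B_r(x)\subset\mathbb{R}^d$ denotes the ball of radius $r$ centred at $x$. *)

(* Defs.v *)
From HB Require Import structures.
From mathcomp Require Import all_boot all_order all_algebra.
From mathcomp Require Import all_classical all_reals all_analysis.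
Set Implicit Arguments.
Unset Strict Implicit.
Unset Printing Implicit Defensive.
Import Order.TTheory GRing.Theory Num.Theory.
Import numFieldNormedType.Exports.
Local Open Scope classical_set_scope.
Local Open Scope ring_scope.

(* The norm that mathcomp-analysis puts on 'rV[R]_n is the sup norm; it induces
   the same topology, but the Euclidean one is needed for balls and distances. *)
Definition enorm (R : realType) (n : nat) (x : 'rV[R]_n) : R :=
  Num.sqrt (\sum_(i < n) x ord0 i ^+ 2).

Definition eball (R : realType) (n : nat) (x : 'rV[R]_n) (r : R) :
  set 'rV[R]_n := [set y | enorm (y - x) < r].

(* Lebesgue measure on R^n is built like completed_lebesgue_measure: an outer
   measure from coverings by half-open boxes, restricted to its Caratheodory
   sigma-algebra, i.e. the sigma-algebra of Lebesgue measurable sets.  The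
   dimension has the form d.+1 because in dimension 0 every box is a singleton
   of volume 1, so that set0 would have positive outer measure. *)
Definition box (R : realType) (n : nat) (ab : 'rV[R]_n * 'rV[R]_n) :
  set 'rV[R]_n :=
  [set x | forall i, ab.1 ord0 i < x ord0 i <= ab.2 ord0 i].

Definition box_volume (R : realType) (n : nat) (ab : 'rV[R]_n * 'rV[R]_n) : R :=
  \prod_(i < n) Num.max 0 (ab.2 ord0 i - ab.1 ord0 i).

Definition box_cover (R : realType) (n : nat) (A : set 'rV[R]_n) :
  set (nat -> 'rV[R]_n * 'rV[R]_n) :=
  [set Q | A `<=` \bigcup_k box (Q k)].

Definition lebesgue_outer (R : realType) (d : nat) (A : set 'rV[R]_d.+1) :
  \bar R :=
  ereal_inf [set (\sum_(0 <= k <oo) (box_volume (Q k))%:E)%E | Q in box_cover A].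

Section lebesgue_outer_measure.
Variables (R : realType) (d : nat).
Local Open Scope ereal_scope.
Implicit Types (A B : set 'rV[R]_d.+1).
Let box_t := ('rV[R]_d.+1 * 'rV[R]_d.+1)%type.
Let vol (ab : box_t) : \bar R := (box_volume ab)%:E.

Let vol_ge0 ab : 0 <= vol ab.
Proof. by rewrite lee_fin; apply: prodr_ge0 => i _; rewrite le_max lexx. Qed.

Lemma lebesgue_outer_ge0 A : 0 <= lebesgue_outer A.
Proof.
apply: le_ereal_inf_tmp => _ [Q _ <-]; apply: nneseries_ge0 => k _ _.
exact: vol_ge0.
Qed.

Lemma lebesgue_outer0 : lebesgue_outer (set0 : set 'rV[R]_d.+1) = 0.
Proof.
apply/eqP; rewrite eq_le lebesgue_outer_ge0 andbT.
apply: ereal_inf_lbound; exists (fun=> (0%R, 0%R)); first by move=> x [].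
apply: eseries0 => k _ _.
by rewrite /box_volume big_ord_recl /= subrr maxxx mul0r.
Qed.

Lemma le_lebesgue_outer :
  {homo @lebesgue_outer R d : A B / A `<=` B >-> A <= B}.
Proof.
move=> A B AB; apply: ereal_inf_le_tmp => _ [Q BQ <-].
by exists Q => //; exact: subset_trans BQ.
Qed.

Lemma lebesgue_outer_sigma_subadditive :
  sigma_subadditive (@lebesgue_outer R d).
Proof.
move=> A; have [[i ioo]|] := pselect (exists i, lebesgue_outer (A i) = +oo).
  rewrite (eseries_pinfty _ _ ioo) ?leey// => n _.
  by rewrite -ltNye (lt_le_trans _ (lebesgue_outer_ge0 _)).
rewrite -forallNE => Aoo.
suff add2e (e : {posnum R}) : lebesgue_outer (\bigcup_n A n) <=
    \sum_(i <oo) lebesgue_outer (A i) + e%:num%:E.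
  by apply/lee_addgt0Pr => _/posnumP[].
rewrite (le_trans _ (epsilon_trick _ _ _))//; last first.
  by move=> n; exact: lebesgue_outer_ge0.
pose P n (Q : nat -> box_t) := box_cover (A n) Q /\
  \sum_(k <oo) vol (Q k) <=
    lebesgue_outer (A n) + (e%:num / (2 ^ n.+1)%:R)%:E.
have [G PG] : {G : nat -> nat -> box_t & forall n, P n (G n)}.
  apply: (@choice _ _ P) => n.
  have en1 : (0 < e%:num / (2 ^ n.+1)%:R)%R by [].
  have fA : lebesgue_outer (A n) \is a fin_num.
    by rewrite ge0_fin_numE ?lebesgue_outer_ge0// ltey; apply/eqP/Aoo.
  have [_ [Q AQ <-] QA] := lb_ereal_inf_adherent en1 fA.
  by exists Q; split => //; exact: ltW.
have volG_ge0 x : 0 <= (vol \o uncurry G) x by exact: vol_ge0.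
apply: (@le_trans _ _ (\esum_(i in setT) (vol \o uncurry G) i)).
  apply: ereal_inf_lbound => /=.
  have /card_esym/ppcard_eqP[f] := card_nat2.
  exists (uncurry G \o f).
    move=> t [i _ /(PG i).1[j _ Gt]]; exists (f^-1%FUN (i, j)) => //=.
    by rewrite invK ?inE.
  rewrite -(esum_pred_image (vol \o uncurry G) _ xpredT) ?[fun=> _]set_true//.
  by rewrite image_eq.
rewrite (_ : esum _ _ = \sum_(i <oo) \sum_(j <oo) vol (G i j)); last first.
  pose J : nat -> set (nat * nat) := fun i => [set (i, j) | j in setT].
  rewrite (_ : setT = \bigcup_k J k); last first.
    by rewrite predeqE => -[a b]; split => // _; exists a => //; exists b.
  rewrite esum_bigcupT /=; last 2 first.
    - apply/trivIsetP => i j _ _ ij.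
      rewrite predeqE => -[n m] /=; split => //= -[] [_] _ [<-{n} _].
      by move=> [m' _] [] /esym/eqP; rewrite (negbTE ij).
    - by move=> /= [n m]; exact: vol_ge0.
  rewrite -(image_id [set: nat]) -fun_true esum_pred_image//; last first.
    by move=> n _; exact: esum_ge0.
  apply: eq_eseriesr => /= j _.
  rewrite -(esum_pred_image (vol \o uncurry G) (pair j) predT)//=; last first.
    by move=> ? ? _ _; exact: (@can_inj _ _ _ snd).
  by congr esum; rewrite predeqE => -[a b]; split; move=> [i _ <-]; exists i.
apply: lee_lim.
- apply: is_cvg_nneseries => n *.
  by apply: nneseries_ge0 => m *; exact: (volG_ge0 (n, m)).
- apply: is_cvg_nneseries => n *; apply: adde_ge0 => //.
  exact: lebesgue_outer_ge0.
- by near=> n; apply: lee_sum => i _; exact: (PG i).2.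
Unshelve. all: by end_near. Qed.

HB.instance Definition _ := isOuterMeasure.Build R 'rV[R]_d.+1
  (@lebesgue_outer R d) lebesgue_outer0 lebesgue_outer_ge0 le_lebesgue_outer
  lebesgue_outer_sigma_subadditive.

End lebesgue_outer_measure.

Notation lebesgue_rV R d := (caratheodory_type (@lebesgue_outer R d)).

Definition lebesgue_measure_rV (R : realType) (d : nat) :
  set (lebesgue_rV R d) -> \bar R := @lebesgue_outer R d.

HB.instance Definition _ (R : realType) (d : nat) :=
  isMeasure.Build _ _ _ (@lebesgue_measure_rV R d)
    (@caratheodory_measure0 _ _ (@lebesgue_outer R d))
    (@caratheodory_measure_ge0 _ _ (@lebesgue_outer R d))
    (@caratheodory_measure_sigma_additive _ _ (@lebesgue_outer R d)).

(* The real line with the domain sigma-algebra of completed_lebesgue_measure. *)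
Notation lebesgue_R R := (caratheodory_type ((@wlength R idfun)^*)%mu).

(* Main.v *)
From HB Require Import structures.
Require Import Defs.
From mathcomp Require Import all_boot all_order all_algebra.
From mathcomp Require Import all_classical all_reals all_analysis.
From mathcomp Require Import measurable_realfun lra.
Import Order.TTheory GRing.Theory Num.Theory.
Import numFieldNormedType.Exports.
Local Open Scope classical_set_scope.
Local Open Scope ring_scope.

(* If |V| > eps a.e. on a ball, then for every y in a smaller ball, outside a
   null set, the inner integral is at least eps^2 times the integral of k(|z|)
   over a small ball.  In polar coordinates the latter is a positive multiple of
   the divergent integral of r^d k(r), so the inner integral is infinite on a
   set of positive measure; no joint measurability or Tonelli is needed.

   Polar coordinates here mean that the law of x |-> |x - y| under Lebesgue
   measure has density w (d+1) r^d, where w is the volume of the unit ball.  By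
   homogeneity of the outer measure the law agrees with this density on the
   rays ]-oo, b], hence on Borel sets, and by completeness on Lebesgue
   measurable sets, which is what a merely Lebesgue measurable k requires. *)

(** * Boxes covered by countably many boxes *)

(* Induction on n: integrating the hypothesis over the last coordinate replaces
   the weight c k by c k times the length of the last side of the k-th box. *)
Lemma box_cover_volume (R : realType) (n : nat) (a b : nat -> R) (M : R)
    (c : nat -> R) (p q : nat -> nat -> R) :
  0 <= M -> (forall k, 0 <= c k) ->
  (forall x : nat -> R, (forall i, (i < n)%N -> x i \in `]a i, b i]) ->
    (M%:E <= \sum_(0 <= k <oo)
      (c k * \prod_(i < n) \1_(`]p k i, q k i]%classic) (x i))%:E)%E) ->
  ((M * \prod_(i < n) Num.max 0 (b i - a i))%:E <=
   \sum_(0 <= k <oo) (c k * \prod_(i < n) Num.max 0 (q k i - p k i))%:E)%E.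
Proof.
elim: n M c => [|n IHn] M c M0 c0 Mle.
  have /Mle : forall i, (i < 0)%N -> (0:R) \in `]a i, b i] by [].
  rewrite big_ord0 mulr1.
  by under eq_eseriesr do rewrite big_ord0;
    under [X in _ -> (_ <= X)%E]eq_eseriesr do rewrite big_ord0.
have max0 (u : R) : 0 <= Num.max 0 u by rewrite le_max lexx.
have indic0 A (t : R) : 0 <= \1_A t :> R by rewrite indicE.
rewrite big_ord_recr/= [X in (X%:E <= _)%E]mulrA mulrAC.
under eq_eseriesr do rewrite big_ord_recr/= mulrA mulrAC.
apply: IHn => [|k|x abx]; [exact: mulr_ge0|exact: mulr_ge0|].
(* If [b n <= a n], the last side contributes the factor 0 and the left-hand side vanishes. *)
have [ab|ba] := ltP (a n) (b n); last first.
  rewrite (_ : Num.max 0 (b n - a n) = 0) ?mulr0.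
    by apply: nneseries_ge0 => k _ _; rewrite lee_fin !mulr_ge0 ?prodr_ge0.
  by apply/max_idPl; rewrite subr_le0.
pose mu := @lebesgue_measure R.
have mI (u v : R) : measurable (`]u, v]%classic : set R)
  by exact: measurable_itv.
have muI u v : mu `]u, v]%classic = (Num.max 0 (v - u))%:E.
  rewrite /mu lebesgue_measure_itv/= lte_fin; case: ltP => uv.
    by rewrite -EFinB max_r// subr_ge0 ltW.
  by rewrite max_l// subr_le0.
rewrite EFinM -muI -integral_cst//.
pose P k := \prod_(i < n) \1_(`]p k i, q k i]%classic) (x i) : R.
have P0 k : 0 <= P k by exact: prodr_ge0.
have mf k : measurable_fun `]a n, b n]%classic
    (EFin \o fun t : R => c k * P k * \1_(`]p k n, q k n]%classic) t).
  apply/measurable_EFinP; apply: measurable_funM => //.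
apply: (@le_trans _ _ (\int[mu]_(t in `]a n, b n]) \sum_(0 <= k <oo)
   (c k * P k * \1_(`]p k n, q k n]%classic) t)%:E)%E).
  apply: ge0_le_integral => //.
  - apply: ge0_emeasurable_sum => k; last by move=> _; exact: mf.
    by move=> t _ _; rewrite lee_fin !mulr_ge0.
  (* [x'] appends [t] to [x] as coordinate [n], so that the hypothesis applies for each [t]. *)
  - move=> t tab; pose x' i := if (i < n)%N then x i else t.
    apply: (le_trans (Mle x' _)).
      move=> i; rewrite ltnS leq_eqVlt /x' => /orP[/eqP->|/[dup] iltn ->].
        by rewrite ltnn.
      exact: abx.
    apply: lee_nneseries => k _.
      by rewrite lee_fin mulr_ge0 ?prodr_ge0.
    rewrite big_ord_recr/= /x' ltnn mulrA; under eq_bigr do rewrite ltn_ord.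
    by [].
rewrite integral_nneseries//; last first.
  by move=> k t _; rewrite lee_fin !mulr_ge0.
apply: lee_nneseries => k _ /=.
  by move=> _; apply: integral_ge0 => t _; rewrite lee_fin !mulr_ge0.
under eq_integral do rewrite EFinM.
rewrite ge0_integralZl//; last 2 first.
  - by apply/measurable_EFinP; exact: measurable_indic.
  - by rewrite lee_fin mulr_ge0.
rewrite integral_indic// -/(P k) mulrAC [leRHS]EFinM.
apply: lee_wpmul2l; first by rewrite lee_fin mulr_ge0.
by rewrite -muI le_measure// ?inE//; exact: measurableI.
Qed.

(** * Lebesgue outer measure: boxes, homotheties, half-spaces *)

Section lebesgue_outer_box.
Variables (R : realType) (d : nat).
Implicit Types (A B : set 'rV[R]_d.+1) (ab : 'rV[R]_d.+1 * 'rV[R]_d.+1).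

Lemma box_volume_ge0 ab : 0 <= box_volume ab.
Proof. by apply: prodr_ge0 => i _; rewrite le_max lexx. Qed.

(** This is [box_cover_volume] with [M] and all weights equal to 1: at each point of the box, some
    covering box contributes an indicator 1. [inord] translates the natural indices used there. *)
Lemma box_volume_le_outer ab : ((box_volume ab)%:E <= lebesgue_outer (box
  ab))%E.
Proof.
apply: le_ereal_inf_tmp => _ [Q abQ <-].
have volE (q : 'rV[R]_d.+1 * 'rV[R]_d.+1) : box_volume q = \prod_(i < d.+1)
    Num.max 0 (q.2 ord0 (inord i) - q.1 ord0 (inord i)).
  by rewrite /box_volume; apply: eq_bigr => i _; rewrite inord_val.
have := @box_cover_volume R d.+1 (fun i => ab.1 ord0 (inord i))
  (fun i => ab.2 ord0 (inord i)) 1 (fun=> 1)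
  (fun k i => (Q k).1 ord0 (inord i)) (fun k i => (Q k).2 ord0 (inord i))
  ler01 (fun=> ler01).
set cov := (forall x : nat -> R, _); have cov1 : cov.
  move=> x abx.
  have [|k _ Qkx] := abQ (\row_i x i).
    by move=> i; have := abx i (ltn_ord i); rewrite mxE inord_val in_itv.
  rewrite (@nneseriesD1 _ _ k)//; last first.
    by move=> j _; rewrite lee_fin mul1r; apply: prodr_ge0 => i _;
      rewrite indicE.
  rewrite big1 ?mulr1 ?leeDl//.
    apply: nneseries_ge0 => j _ _.
    by rewrite lee_fin mul1r; apply: prodr_ge0 => i _; rewrite indicE.
  move=> i _; rewrite indicE mem_set//= in_itv/= inord_val.
  by have := Qkx i; rewrite mxE.
move/(_ cov1).
rewrite mul1r -volE => /le_trans; apply.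
by apply: lee_nneseries => k _; rewrite mul1r -volE lee_fin ?box_volume_ge0.
Qed.

Lemma lebesgue_outer_le_box_volume ab :
  (lebesgue_outer (box ab) <= (box_volume ab)%:E)%E.
Proof.
apply: ereal_inf_lbound.
(* The sequence is padded with [(0, 0)], whose volume is 0 because the dimension is positive. *)
exists (fun k : nat => if k == 0%N then ab else (0, 0)).
  by move=> x abx; exists 0%N.
rewrite (@nneseriesD1 _ _ 0%N)//; last first.
  by move=> k _; rewrite lee_fin box_volume_ge0.
rewrite eseries_cond eseries0 ?adde0//.
move=> [|k] _ //= _.
by rewrite /box_volume big_ord_recl/= subrr maxxx mul0r.
Qed.

Lemma lebesgue_outer_box ab : lebesgue_outer (box ab) = (box_volume ab)%:E.
Proof.
by apply/eqP; rewrite eq_le lebesgue_outer_le_box_volume box_volume_le_outer.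
Qed.

(** The map z |-> y + c z carries a cover of [A] to a cover of [B] and multiplies each of the d+1
    sides by [c]. Equalities come from applying it also to the inverse map. *)
Lemma lebesgue_outer_homothety A B (y : 'rV[R]_d.+1) (c : R) : 0 < c ->
  (forall x, B x -> A (c^-1 *: (x - y))) ->
  (lebesgue_outer B <= (c ^+ d.+1)%:E * lebesgue_outer A)%E.
Proof.
move=> c0 BA; rewrite -lee_pdivrMl ?exprn_gt0//.
apply: le_ereal_inf_tmp => _ [Q AQ <-].
rewrite lee_pdivrMl ?exprn_gt0// -nneseriesZl; last first.
  by move=> k _; rewrite lee_fin box_volume_ge0.
apply: ereal_inf_lbound.
exists (fun k => (y + c *: (Q k).1, y + c *: (Q k).2)).
  move=> x /BA /AQ[k _ Qkx]; exists k => // i.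
  have := Qkx i; rewrite !mxE/= ltr_pdivlMl// ler_pdivrMl//.
  by rewrite ltrBrDl lerBlDl.
apply: eq_eseriesr => k _; rewrite -EFinM; congr EFin.
rewrite /box_volume -[X in c ^+ X]card_ord -prodr_const -big_split/=.
apply: eq_bigr => i _; rewrite !mxE opprD addrACA subrr add0r -mulrBr.
by rewrite maxr_pMr ?mulr0// ltW.
Qed.

(** Cutting every covering box at height [t] in direction [i] splits its volume exactly, so one
    cover of [X] yields covers of both parts of [X] with the same total volume. *)
Lemma halfspace_caratheodory (i : 'I_d.+1) (t : R) :
  ((@lebesgue_outer R d).-caratheodory [set x | x ord0 i <= t])%classic.
Proof.
apply: le_caratheodory_measurable => X /=.
apply: le_ereal_inf_tmp => _ [Q XQ <-].
pose upd (v : 'rV[R]_d.+1) s : 'rV[R]_d.+1 :=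
    \row_j (if j == i then s else v ord0 j).
(* If [t] misses the i-th side, one of the two halves gets a nonpositive side, which [box_volume]
   counts as 0. *)
pose Q1 k := ((Q k).1, upd (Q k).2 (Num.min ((Q k).2 ord0 i) t)).
pose Q2 k := (upd (Q k).1 (Num.max ((Q k).1 ord0 i) t), (Q k).2).
have volQ k : box_volume (Q k) = box_volume (Q1 k) + box_volume (Q2 k).
  rewrite /box_volume (bigD1 i)//= [X in _ = X + _](bigD1 i)//=.
  rewrite [X in _ = _ + X](bigD1 i)//=.
  rewrite [in X in _ = X + _](eq_bigr (fun j => Num.max 0
    ((Q k).2 ord0 j - (Q k).1 ord0 j))); last first.
    by move=> j /negbTE ji; rewrite mxE ji.
  rewrite [in X in _ = _ + X](eq_bigr (fun j => Num.max 0
    ((Q k).2 ord0 j - (Q k).1 ord0 j))); last first.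
    by move=> j /negbTE ji; rewrite mxE ji.
  rewrite -mulrDl !mxE eqxx; congr (_ * _).
  set a := (Q k).1 ord0 i; set b := (Q k).2 ord0 i.
  rewrite !maxEle !minEle !subr_ge0.
  by repeat case: ifPn; rewrite -?ltNge; lra.
rewrite (eq_eseriesr (g := fun k =>
  (box_volume (Q1 k))%:E + (box_volume (Q2 k))%:E)%E); last first.
  by move=> k _; rewrite volQ EFinD.
rewrite nneseriesD; last 2 first.
  by move=> k _; rewrite lee_fin box_volume_ge0.
  by move=> k _; rewrite lee_fin box_volume_ge0.
apply: leeD; apply: ereal_inf_lbound.
- exists Q1 => // x [/XQ[k _ Qkx]] /= xt; exists k => // j.
  have := Qkx j; rewrite /= mxE; case: eqP => [->|//].
  by move=> /andP[-> xb]; rewrite le_min xb xt.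
- exists Q2 => // x [/XQ[k _ Qkx]] /= /negP; rewrite -ltNge => xt;
    exists k => // j.
  have := Qkx j; rewrite /= mxE; case: eqP => [->|//].
  by move=> /andP[xa ->]; rewrite gt_max xa xt.
Qed.

End lebesgue_outer_box.

(** * Measurability and volume of Euclidean balls *)

Section euclidean_balls.
Variables (R : realType) (d : nat).
Local Notation mu := (@lebesgue_measure_rV R d).
Implicit Types (x y : 'rV[R]_d.+1).

Lemma measurable_coord (i : 'I_d.+1) :
  measurable_fun [set: lebesgue_rV R d]
    (fun x : lebesgue_rV R d => (x : 'rV[R]_d.+1) ord0 i).
Proof.
apply: (measurability _ (RGenOInfty.measurableE R)) => //.
move=> _ [_ [a ->] <-]; rewrite setTI.
rewrite (_ : _ @^-1` _ = ~` [set x : 'rV[R]_d.+1 | x ord0 i <= a]).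
  by apply: measurableC; exact: halfspace_caratheodory.
by apply/seteqP; split => x /=; rewrite in_itv/= andbT ltNge => /negP.
Qed.

Lemma measurable_enorm_sub y :
  measurable_fun [set: lebesgue_rV R d]
    (fun x : lebesgue_rV R d => enorm ((x : 'rV[R]_d.+1) - y)).
Proof.
rewrite /enorm; apply: measurableT_comp.
  by apply: continuous_measurable_fun; exact: sqrt_continuous.
apply: measurable_sum => i; apply: measurable_funX.
under eq_fun do rewrite !mxE.
by apply: measurable_funB => //; exact: measurable_coord.
Qed.

Lemma enorm_ge0 {n} (x : 'rV[R]_n) : 0 <= enorm x.
Proof. exact: sqrtr_ge0. Qed.

Lemma enormZ {n} (c : R) (x : 'rV[R]_n) : enorm (c *: x) = `|c| * enorm x.
Proof.
rewrite /enorm -sqrtr_sqr -sqrtrM ?sqr_ge0//; congr Num.sqrt.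
by rewrite mulr_sumr; apply: eq_bigr => i _; rewrite mxE exprMn.
Qed.

Lemma normr_coord_le_enorm {n} (x : 'rV[R]_n) i : `|x ord0 i| <= enorm x.
Proof.
rewrite /enorm -sqrtr_sqr ler_wsqrtr// (bigD1 i)//= lerDl.
by apply: sumr_ge0 => j _; exact: sqr_ge0.
Qed.

Definition closed_eball y (r : R) : set (lebesgue_rV R d) :=
  [set x | enorm ((x : 'rV[R]_d.+1) - y) <= r].

Lemma measurable_closed_eball y r : measurable (closed_eball y r).
Proof.
have := measurable_enorm_sub y; move=> /(_ measurableT `]-oo, r]%classic).
rewrite setTI (_ : _ @^-1` _ = closed_eball y r)//.
by apply; exact: measurable_itv.
Qed.

(** The constant w; it stays unspecified, and only its finiteness and positivity enter. *)
Definition unit_ball_volume : R := fine (mu (closed_eball 0 1)).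

Lemma unit_ball_volumeE : mu (closed_eball 0 1) = unit_ball_volume%:E.
Proof.
rewrite /unit_ball_volume fineK// ge0_fin_numE ?measure_ge0//.
(* Boxes exclude their lower faces, hence the corner -2 instead of -1. *)
apply: (@le_lt_trans _ _
  (lebesgue_outer (box (const_mx (-2) : 'rV[R]_d.+1, const_mx 1)))).
  apply: le_outer_measure => x; rewrite /closed_eball/= subr0 => x1 i;
    rewrite !mxE.
  have := le_trans (normr_coord_le_enorm x i) x1;
    rewrite ler_norml => /andP[+ ->].
  by rewrite andbT; apply: lt_le_trans; rewrite ltrN2 ltr1n.
by rewrite lebesgue_outer_box ltry.
Qed.

Lemma unit_ball_volume_gt0 : 0 < unit_ball_volume.
Proof.
rewrite -lte_fin -unit_ball_volumeE.
(* In this cube each squared coordinate is at most 1/(d+1), so the d+1 squares sum to at most 1. *)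
apply: (@lt_le_trans _ _
  (lebesgue_outer (box (0 : 'rV[R]_d.+1, const_mx (d.+1%:R^-1))))).
  rewrite lebesgue_outer_box lte_fin; apply: prodr_gt0 => i _.
  by rewrite !mxE subr0 lt_max invr_gt0 ltr0n orbT.
apply: le_outer_measure => x /= x1; rewrite /closed_eball/= subr0.
rewrite /enorm -[leRHS]sqrtr1 ler_wsqrtr//.
apply: (@le_trans _ _ (\sum_(i < d.+1) d.+1%:R^-1)); last first.
  by rewrite sumr_const card_ord -[X in _ X _]mulr_natr mulVf ?pnatr_eq0.
apply: ler_sum => i _; have := x1 i; rewrite !mxE => /andP[x0 xd].
rewrite expr2 -[leRHS]mulr1; apply: ler_pM; rewrite ?(ltW x0)//;
  apply: (le_trans xd).
by rewrite invf_le1 ?ler1n ?ltr0n.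
Qed.

(** For positive radius, a homothety from the unit ball and its inverse give the two inequalities.
    Radius 0, where the homothety degenerates, is squeezed by small balls. *)
Lemma lebesgue_measure_closed_eball y (r : R) : 0 <= r ->
  mu (closed_eball y r) = (unit_ball_volume * r ^+ d.+1)%:E.
Proof.
have pos (s : R) : 0 < s ->
    mu (closed_eball y s) = (unit_ball_volume * s ^+ d.+1)%:E.
  move=> s0; apply/eqP; rewrite eq_le; apply/andP; split.
    rewrite mulrC EFinM -unit_ball_volumeE.
    apply: (@lebesgue_outer_homothety _ _ _ _ y) => // x;
      rewrite /closed_eball/= subr0.
    by rewrite enormZ gtr0_norm ?invr_gt0// ler_pdivrMl// mulr1.
  rewrite EFinM muleC -unit_ball_volumeE -lee_pdivlMl ?exprn_gt0//.
  (* Factor [s^-1] and translation [- s^-1 *: y] describe the inverse of z |-> y + s z. *)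
  rewrite -exprVn; apply: (@lebesgue_outer_homothety _ _ _ _ (- s^-1 *: y)).
    by rewrite invr_gt0.
  move=> x; rewrite /closed_eball/= subr0 invrK scaleNr opprK scalerDr scalerA
    mulfV ?gt_eqF//.
  by rewrite scale1r addrK enormZ gtr0_norm// => x1;
    rewrite -[leRHS]mulr1 ler_pM2l.
rewrite le_eqVlt => /orP[/eqP<-|]; last exact: pos.
rewrite expr0n/= mulr0; apply/eqP; rewrite eq_le measure_ge0 andbT.
apply/lee_addgt0Pr => e e0; rewrite add0e.
(* The bound 1 gives s^(d+1) <= s, and the other bound gives w s <= e. *)
pose s := Num.min 1 (e / unit_ball_volume).
have s0 : 0 < s by rewrite lt_min ltr01 divr_gt0// unit_ball_volume_gt0.
apply: (@le_trans _ _ (mu (closed_eball y s))).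
  by apply: le_outer_measure => x; rewrite /closed_eball/= => /le_trans; apply;
    exact: ltW.
rewrite pos// lee_fin mulrC -ler_pdivlMr ?unit_ball_volume_gt0//.
apply: (@le_trans _ _ s); last by rewrite ge_min lexx orbT.
rewrite exprS -[leRHS]mulr1 ler_pM2l//.
by apply: exprn_ile1; rewrite ?(ltW s0)// /s ge_min lexx.
Qed.

End euclidean_balls.

(** * Integration against a measure with a density *)

Section integral_density.
Context d (T : measurableType d) (R : realType).
Variables (mu nu : {measure set T -> \bar R}) (D : set T) (g : T -> R).
Hypothesis mD : measurable D.
Hypothesis mg : measurable_fun D g.
Hypothesis g0 : forall x, D x -> 0 <= g x.
Hypothesis nuE : forall A, measurable A -> A `<=` D ->
  (nu A = \int[mu]_(x in A) (g x)%:E)%E.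
Import HBNNSimple.
Local Open Scope ereal_scope.

Let nnsfun_density (h : {nnsfun T >-> R}) :
  \int[nu]_(x in D) (h x)%:E = \int[mu]_(x in D) ((h x)%:E * (g x)%:E).
Proof.
have mh r : measurable (h @^-1` [set r]) by [].
transitivity (\sum_(r \in range h) (r%:E * nu (h @^-1` [set r] `&` D))).
  under eq_integral do rewrite fimfunE -fsumEFin//.
  rewrite ge0_integral_fsum//; last 2 first.
  - by move=> r; apply/measurable_EFinP; exact: measurable_funM.
  - by move=> r x _; rewrite nnfun_muleindic_ge0.
  by apply: eq_fsbigr => r _; rewrite integralZl_indic_nnsfun// integral_indic.
transitivity (\sum_(r \in range h)
    \int[mu]_(x in D) ((r * \1_(h @^-1` [set r]) x)%:E * (g x)%:E)); last first.
  rewrite -ge0_integral_fsum//; last 2 first.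
  - move=> r; apply: emeasurable_funM; last exact/measurable_EFinP.
    by apply/measurable_EFinP; exact: measurable_funM.
  - by move=> r x Dx; rewrite mule_ge0 ?nnfun_muleindic_ge0 ?lee_fin ?g0.
  apply: eq_integral => x /[!inE] Dx.
  rewrite -ge0_mule_fsuml; last by move=> r; exact: nnfun_muleindic_ge0.
  by rewrite fsumEFin// -fimfunE.
apply: eq_fsbigr => r /[!inE] -[x _ <-].
under eq_integral do rewrite EFinM -muleA.
rewrite ge0_integralZl//; last 3 first.
- apply: emeasurable_funM; last exact/measurable_EFinP.
  by apply/measurable_EFinP; exact: measurable_indic.
- by move=> y Dy; rewrite mule_ge0 ?lee_fin ?g0.
- by rewrite lee_fin.
congr (_ * _).
rewrite nuE//; last by exact: measurableI.
rewrite setIC integral_mkcondr; apply: eq_integral => y _.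
by rewrite patchE indicE; case: ifPn; rewrite ?mul1e ?mul0e.
Qed.

(** Simple functions are treated level set by level set in [nnsfun_density]; monotone convergence on
    both sides does the rest. The sign of [g] is prescribed on [D] only, since [radial_density] may
    be negative at negative radii. *)
Lemma ge0_integral_density (f : T -> \bar R) : measurable_fun D f ->
  (forall x, D x -> 0 <= f x) ->
  \int[nu]_(x in D) f x = \int[mu]_(x in D) (f x * (g x)%:E).
Proof.
move=> mf f0; pose h := nnsfun_approx mD mf.
have hf x : D x -> (EFin \o h ^~ x) n @[n --> \oo] --> f x.
  by move=> Dx; exact: cvg_nnsfun_approx.
transitivity (limn (fun n => \int[nu]_(x in D) (h n x)%:E)).
  rewrite -monotone_convergence//.
  - by apply: eq_integral => x /[!inE] Dx; apply/esym/cvg_lim => //; exact: hf.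
  - by move=> n; apply/measurable_EFinP; exact: measurable_funTS.
  - by move=> n x _; rewrite lee_fin.
  - by move=> x _ m n mn; rewrite lee_fin; exact/lefP/nd_nnsfun_approx.
under eq_fun do rewrite nnsfun_density.
rewrite -monotone_convergence//.
- apply: eq_integral => x /[!inE] Dx; apply/cvg_lim => //.
  by apply: cvgeZr => //; exact: hf.
- move=> n; apply: emeasurable_funM; last exact/measurable_EFinP.
  by apply/measurable_EFinP; exact: measurable_funTS.
- by move=> n x Dx; rewrite mule_ge0 ?lee_fin ?g0.
- move=> x Dx m n mn; rewrite lee_wpmul2r ?lee_fin ?g0//.
  exact/lefP/nd_nnsfun_approx.
Qed.

End integral_density.

(** * Integrals of powers and uniqueness of measures on the line *)

Lemma integral_exprn (R : realType) (n : nat) (c b : R) : 0 <= b ->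
  (\int[lebesgue_measure]_(r in `[0%R, b]) (c * n.+1%:R * r ^+ n)%:E)%E =
  (c * b ^+ n.+1)%:E.
Proof.
rewrite le_eqVlt => /orP[/eqP<-|b0].
  by rewrite set_itv1 integral_set1 expr0n/= mulr0.
rewrite (@continuous_FTC2 _ _ (fun r => c * r ^+ n.+1))//.
- by rewrite expr0n/= mulr0 sube0.
- apply: continuous_subspaceT => x.
  by apply: cvgM; [exact: cvg_cst|exact: exprn_continuous].
- split.
  + move=> x _; apply: derivableM;
      [exact: derivable_cst|exact: exprn_derivable].
  + apply: cvg_at_right_filter; apply: cvgM;
      [exact: cvg_cst|exact: exprn_continuous].
  + apply: cvg_at_left_filter; apply: cvgM;
      [exact: cvg_cst|exact: exprn_continuous].
- move=> x _; rewrite derive1Ml; last exact: exprn_derivable.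
  by rewrite exp_derive1 mulrA.
Qed.

Section ocitv_unique.
Variables (R : realType) (m1 m2 : {measure set (measurableTypeR R) -> \bar R}).
Local Open Scope ereal_scope.

(** Differences of rays are the intervals []a, b]], a generating family closed under intersection.
    Finiteness on rays permits the subtraction and makes the exhausting intervals finite. *)
Lemma measure_unique_Nyc :
  (forall b : R, m1 `]-oo, b]%classic \is a fin_num) ->
  (forall b : R, m1 `]-oo, b]%classic = m2 `]-oo, b]%classic) ->
  forall A, measurable A -> m1 A = m2 A.
Proof.
move=> fm1 m12.
have mray (b : R) : measurable (`]-oo, b]%classic : set (measurableTypeR R)).
  exact: measurable_itv.
have m12I (a b : R) : (a < b)%R -> m1 `]a, b]%classic = m2 `]a, b]%classic.
  move=> ab; have -> : `]a, b]%classic = `]-oo, b] `\` `]-oo, a] :> set R.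
    apply/seteqP; split => x /=; rewrite !in_itv/=.
      by move=> /andP[ax ->]; split => //; rewrite leNgt ax.
    by move=> [-> /negP]; rewrite -ltNge => ->.
  have rayI : `]-oo, b] `&` `]-oo, a] = `]-oo, a]%classic :> set R.
    apply/seteqP; split => x /=; rewrite !in_itv/=; first by case.
    by move=> xa; split => //; exact: (le_trans xa (ltW ab)).
  have moo : m1 `]-oo, b]%classic < +oo by rewrite ltey_eq fm1.
  have moo2 : m2 `]-oo, b]%classic < +oo by rewrite -m12.
  rewrite !measureD// ?rayI.
  by congr (_ - _); exact: m12.
apply: (@measure_unique _ R (measurableTypeR R) (@ocitv R)
  (fun k : nat => `](- k%:R)%R, k%:R]%classic) _ _ _ _ m1 m2).
- by [].
- exact: ocitvI.
- by move=> k; exists (- k%:R, k%:R)%R.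
- apply/seteqP; split => // x _; pose t : R := x.
  have : (`|t| < (Num.bound `|t|)%:R)%R by exact: archi_boundP.
  rewrite ltr_norml => /andP[lt_t t_lt]; exists (Num.bound `|t|) => //=.
  by rewrite in_itv/= lt_t ltW.
- move=> A /ocitvP[->|[[a b] ab ->]]; first by rewrite !measure0.
  exact: m12I.
- move=> k; apply: (@le_lt_trans _ _ (m1 `]-oo, k%:R]%classic));
    last by rewrite ltey_eq fm1.
  apply: le_measure; rewrite ?inE;
    [exact: measurable_itv|exact: measurable_itv|].
  by move=> x /=; rewrite !in_itv/= => /andP[].
Qed.

End ocitv_unique.

(** * Law of the distance to a point, on Borel sets *)

Section radial_measure.
Variables (R : realType) (d : nat) (y : 'rV[R]_d.+1).
Local Notation mu := (@lebesgue_measure_rV R d).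
Local Open Scope ereal_scope.

Definition dist_to (x : lebesgue_rV R d) : R := enorm ((x : 'rV[R]_d.+1) - y).

(** The derivative of the ball volume w r^(d+1), that is, the area of the sphere of radius [r]. *)
Definition radial_density (r : R) : R :=
  (unit_ball_volume R d * d.+1%:R * r ^+ d)%R.

Lemma radial_density_ge0 (r : R) : (0 <= r -> 0 <= radial_density r)%R.
Proof.
by move=> r0; rewrite !mulr_ge0 ?exprn_ge0// ltW// unit_ball_volume_gt0.
Qed.

Lemma measurable_radial_density (D : set (measurableTypeR R)) :
  measurable_fun D radial_density.
Proof.
by apply: measurable_funM => //; exact: measurable_funX.
Qed.

(** Both sides are measures in [X], so agreement on rays suffices. The preimage of []-oo, b]] is a
    closed ball, whose volume is the integral of the density by [integral_exprn]; for negative [b]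
    both sides vanish. *)
Lemma radial_measure_borel (X : set (measurableTypeR R)) : measurable X ->
  mu (dist_to @^-1` X) =
  \int[lebesgue_measure]_(r in X `&` `[0%R, +oo[) (radial_density r)%:E.
Proof.
have mC : measurable (`[0%R, +oo[%classic : set (measurableTypeR R)).
  exact: measurable_itv.
have mrad : measurable_fun [set: lebesgue_rV R d]
    (dist_to : _ -> measurableTypeR R).
  exact: measurable_enorm_sub.
have mden D : measurable_fun D (EFin \o radial_density).
  by apply/measurable_EFinP; exact: measurable_radial_density.
pose m2 (A : set (measurableTypeR R)) :=
  \int[@lebesgue_measure R]_(r in A `&` `[0%R, +oo[) (radial_density r)%:E.
have den0 (A : set R) r : (A `&` `[0%R, +oo[) r -> 0 <= (radial_density r)%:E.
  by move=> [_ /=]; rewrite in_itv/= andbT lee_fin => /radial_density_ge0.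
have m2_0 : m2 set0 = 0 by rewrite /m2 set0I integral_set0.
have m2_ge0 A : 0 <= m2 A by apply: integral_ge0 => r; exact: den0.
have m2_sigma : semi_sigma_additive m2.
  move=> F mF tF mUF; rewrite /m2 setI_bigcupl ge0_integral_bigcup//.
  - apply: is_cvg_ereal_nneg_natsum_cond => n _ _.
    by apply: integral_ge0 => r; exact: den0.
  - by move=> k; exact: measurableI.
  - exact: mden.
  - by move=> r [k _ [Fkr Cr]]; exact: (den0 (F k)).
  - exact: trivIset_setIr.
pose m2M := isMeasure.Build _ _ _ m2 m2_0 m2_ge0 m2_sigma.
pose m2' : {measure set (measurableTypeR R) -> \bar R} := HB.pack m2 m2M.
pose m1 : {measure set (measurableTypeR R) -> \bar R} :=
  measure_function_pushforward__canonical__measure_function_Measure mu mrad.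
have preim b : dist_to @^-1` `]-oo, b]%classic = closed_eball R d y b.
  by apply/seteqP; split => x; rewrite /= in_itv.
have closed_eball_neg b : (b < 0)%R -> closed_eball R d y b = set0.
  move=> b0; apply/seteqP; split => x //; rewrite /closed_eball/= => xb.
  by have := lt_le_trans b0 (enorm_ge0 _ (x - y)); rewrite ltNge xb.
apply: (@measure_unique_Nyc R m1 m2') => b; rewrite /= /pushforward preim.
  have [b0|b0] := leP 0%R b; first by rewrite lebesgue_measure_closed_eball.
  by rewrite closed_eball_neg// measure0.
rewrite /m2; have [b0|b0] := leP 0%R b.
  rewrite lebesgue_measure_closed_eball// -integral_exprn//.
  rewrite (_ : _ `&` _ = `[0%R, b]%classic)//.
  apply/seteqP; split => r /=; rewrite !in_itv/= andbT; first by case=> -> ->.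
  by case/andP => -> ->.
rewrite closed_eball_neg// measure0.
rewrite (_ : _ `&` _ = set0) ?integral_set0//.
apply/seteqP; split => r //=; rewrite !in_itv/= andbT => -[rb r0].
by have := le_lt_trans rb b0; rewrite ltNge r0.
Qed.

End radial_measure.

(** * Passage from Borel to Lebesgue measurable sets *)

Lemma borel_lebesgue_measurable (R : realType) (X : set R) :
  measurable (X : set (measurableTypeR R)) ->
  measurable (X : set (lebesgue_R R)).
Proof. exact: sub_caratheodory. Qed.

Lemma borel_lebesgue_measurable_fun (R : realType) (D : set R) (f : R -> R) :
  measurable_fun [set: measurableTypeR R] f ->
  measurable_fun (D : set (lebesgue_R R)) f.
Proof.
move=> mf; apply: measurable_funTS => _ Y mY.
by apply: borel_lebesgue_measurable; exact: mf.
Qed.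

(** The identity from the Lebesgue to the Borel sigma-algebra is measurable and pushes the completed
    measure forward to [lebesgue_measure]. *)
Lemma ge0_integral_completed (R : realType) (D : set R) (f : R -> \bar R) :
  measurable (D : set (measurableTypeR R)) ->
  measurable_fun (D : set (measurableTypeR R)) f ->
  (forall r, D r -> 0 <= f r)%E ->
  (\int[completed_lebesgue_measure]_(r in D) f r =
   \int[lebesgue_measure]_(r in D) f r)%E.
Proof.
move=> mD mf f0.
have mid : measurable_fun [set: lebesgue_R R]
    (idfun : lebesgue_R R -> measurableTypeR R).
  by move=> _ X mX; rewrite setTI; exact: borel_lebesgue_measurable.
have := @ge0_integral_pushforward _ _ _ _ R _ mid completed_lebesgue_measure
  D f mD mf.
move=> <-; last by move=> r /[!inE]; exact: f0.
exact: eq_measure_integral.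
Qed.

Lemma lebesgue_measurable_decomp (R : realType) (A : set R) :
  measurable (A : set (lebesgue_R R)) ->
  exists X B : set (measurableTypeR R), [/\ measurable X, measurable B,
    lebesgue_measure B = 0%E, X `<=` A & A `<=` X `|` B].
Proof.
move=> mA.
have : (completed_algebra_gen (@lebesgue_measure R)).-sigma.-measurable A.
  by rewrite completed_caratheodory_measurable.
rewrite g_sigma_completed_algebra_genE => -[X mX [N [B [mB B0 NB]]] <-].
exists X, B; split => //.
by move=> r [|/NB]; [left|right].
Qed.

Section radial_lebesgue.
Variables (R : realType) (d : nat) (y : 'rV[R]_d.+1).
Local Notation mu := (@lebesgue_measure_rV R d).
Local Notation dist_to := (dist_to R d y).

Let measurable_dist_to_borel (X : set (measurableTypeR R)) : measurable X ->
  measurable (dist_to @^-1` X).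
Proof.
move=> mX; rewrite -[X in measurable X]setTI.
exact: (measurable_enorm_sub R d y).
Qed.

(** The law of the distance has a density, hence is absolutely continuous. *)
Let dist_to_preimage_null (B : set (measurableTypeR R)) : measurable B ->
  lebesgue_measure B = 0%E -> mu (dist_to @^-1` B) = 0%E.
Proof.
move=> mB B0; rewrite radial_measure_borel//.
have mC : measurable (B `&` `[0, +oo[%classic : set (measurableTypeR R)).
  by apply: measurableI => //; exact: measurable_itv.
rewrite (@ge0_negligible_integral _ _ _ _ _ B)//.
- rewrite (_ : _ `\` _ = set0) ?integral_set0//.
  by apply/seteqP; split => // r [[]].
- by apply/measurable_EFinP; exact: measurable_radial_density.
- by move=> r [_ /=]; rewrite in_itv/= andbT lee_fin; exact: radial_density_ge0.
Qed.

(** The target carries the Lebesgue sigma-algebra. A preimage is that of a Borel set together with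
    part of the preimage of a Borel null set, and the latter part is measurable by completeness. *)
Lemma measurable_dist_to :
  measurable_fun [set: lebesgue_rV R d]
    (dist_to : lebesgue_rV R d -> lebesgue_R R).
Proof.
move=> _ A /lebesgue_measurable_decomp[X [B [mX mB B0 XA AXB]]]; rewrite setTI.
rewrite (_ : _ @^-1` A =
    dist_to @^-1` X `|` (dist_to @^-1` A `&` dist_to @^-1` B)).
  apply: measurableU; first exact: measurable_dist_to_borel.
  apply: (@measure_is_complete_caratheodory R _ (@lebesgue_outer R d)).
  exists (dist_to @^-1` B); split; last exact: subIsetr.
    exact: measurable_dist_to_borel.
  exact: dist_to_preimage_null.
apply/seteqP; split => x /=; last by case=> [/XA|[]].
by move=> Ax; have [|] := AXB _ Ax; [left|right].
Qed.

(** Removing the null set [B] changes neither side, and [A] minus [B] equals the Borel set [X] minus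
    [B], where [radial_measure_borel] applies. *)
Lemma radial_measure (A : set (lebesgue_R R)) : measurable A ->
  A `<=` `[0, +oo[%classic ->
  mu (dist_to @^-1` A) =
  (\int[completed_lebesgue_measure]_(r in A) (radial_density R d r)%:E)%E.
Proof.
move=> mA A0.
have [X [B [mX mB B0 XA AXB]]] := lebesgue_measurable_decomp R A mA.
have XBE : A `\` B = X `\` B.
  apply/seteqP; split => r /= [+ nBr]; last by move=> /XA.
  by move=> /AXB[].
have mXB : measurable (X `\` B : set (measurableTypeR R)) by exact: measurableD.
have mden D : measurable_fun D (EFin \o radial_density R d).
  by apply/measurable_EFinP; exact: measurable_radial_density.
have den0 r : A r -> (0 <= (radial_density R d r)%:E)%E.
  by move=> /A0; rewrite /= in_itv/= andbT lee_fin; exact: radial_density_ge0.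
transitivity (\int[completed_lebesgue_measure]_(r in X `\` B)
    (radial_density R d r)%:E)%E; last first.
  rewrite [RHS](@ge0_negligible_integral _ (lebesgue_R R) _ _ _ B)//.
  - by congr (integral _ _ _); exact/esym.
  - exact: borel_lebesgue_measurable.
  - apply/measurable_EFinP; apply: borel_lebesgue_measurable_fun.
    exact: measurable_radial_density.
rewrite ge0_integral_completed//; last 2 first.
  exact: mden.
  by rewrite -XBE => r [/den0].
have := radial_measure_borel R d y (X `\` B) mXB.
rewrite setIidl => [<-|]; last by rewrite -XBE => r [/A0].
apply/eqP; rewrite eq_le; apply/andP; split.
  apply: (@le_trans _ _
      (mu (dist_to @^-1` (X `\` B)) + mu (dist_to @^-1` B))%E).
    apply: (@le_trans _ _ (mu (dist_to @^-1` (X `\` B) `|` dist_to @^-1` B))).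
      apply: le_outer_measure => x /= /AXB Ax.
      by have [|] := pselect (B (dist_to x)); [right|left; case: Ax].
    exact: outer_measureU2.
  by rewrite (dist_to_preimage_null B)// adde0.
by apply: le_outer_measure => x /= [/XA].
Qed.

End radial_lebesgue.

(* Unlike in ge0_le_integral, f and g need not be measurable: the inner integral
   of the double integral is not known to be measurable in y. *)
Lemma ge0_le_integral_setT d (T : measurableType d) (R : realType)
    (mu : {measure set T -> \bar R}) (f g : T -> \bar R) :
  (forall x, 0 <= f x)%E -> (forall x, f x <= g x)%E ->
  (\int[mu]_(x in setT) f x <= \int[mu]_(x in setT) g x)%E.
Proof.
move=> f0 fg; rewrite !ge0_integralTE// => [|x]; last exact: le_trans (fg x).
by apply: ereal_sup_le => _ [h hf <-]; exists h => // x; exact: le_trans (fg x).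
Qed.

(* (a + b)^2 <= 2 a^2 + 2 b^2 replaces Cauchy-Schwarz. *)
Lemma enormD_le {R : realType} {n} (u v : 'rV[R]_n) (s : R) :
  enorm u <= s -> enorm v <= s -> enorm (u + v) <= 2 * s.
Proof.
have sq (w : 'rV[R]_n) : enorm w <= s -> \sum_(i < n) w ord0 i ^+ 2 <= s ^+ 2.
  move=> ws; rewrite -[leLHS]sqr_sqrtr; last first.
    by apply: sumr_ge0 => i _; exact: sqr_ge0.
  by rewrite lerXn2r ?nnegrE ?sqrtr_ge0 ?(le_trans _ ws)// sqrtr_ge0.
move=> us vs; have s0 : 0 <= s := le_trans (enorm_ge0 _ u) us.
rewrite -[leRHS]ger0_norm ?mulr_ge0// -sqrtr_sqr; apply: ler_wsqrtr.
apply: (@le_trans _ _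
  (2 * \sum_(i < n) u ord0 i ^+ 2 + 2 * \sum_(i < n) v ord0 i ^+ 2)).
  rewrite !mulr_sumr -big_split/=; apply: ler_sum => i _; rewrite mxE.
  have := sqr_ge0 (u ord0 i - v ord0 i); lra.
have := sq u us; have := sq v vs; lra.
Qed.

(** * Divergence of the double integral *)

Section divergence.
Variables (R : realType) (d : nat) (k : R -> R).
Local Notation mu := (@lebesgue_measure_rV R d).
Hypothesis k_ge0 : forall r : R, 0 <= r -> 0 <= k r.
Hypothesis mk : measurable_fun (`[0, +oo[ : set (lebesgue_R R)) k.
Hypothesis kinfty : forall delta : R, 0 < delta ->
  (\int[completed_lebesgue_measure]_(r in `[0%R, delta])
     (r ^+ d * k r)%:E = +oo)%E.

Lemma measurable_radial_kernel (y : 'rV[R]_d.+1) :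
  measurable_fun [set: lebesgue_rV R d] (k \o dist_to R d y).
Proof.
have mC : measurable (`[0, +oo[%classic : set (lebesgue_R R)).
  by apply: borel_lebesgue_measurable; exact: measurable_itv.
move=> _ B mB.
have := measurable_dist_to R d y measurableT _ (mk mC _ mB).
rewrite !setTI; congr (measurable _); apply/seteqP; split => x /=;
  first by case.
by split => //; rewrite in_itv/= enorm_ge0.
Qed.

(** Pushing forward along the distance and inserting its density turns the integral into a positive
    multiple of the divergent integral of r^d k(r) over [0, s]. *)
Lemma integral_radial_kernel (y : 'rV[R]_d.+1) (s : R) : 0 < s ->
  (\int[mu]_(x in dist_to R d y @^-1` `[0%R, s]%classic)
     (k (dist_to R d y x))%:E = +oo)%E.
Proof.
move=> s0.
pose D : set (lebesgue_R R) := `[0, s]%classic.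
have mD : measurable D by apply: borel_lebesgue_measurable;
  exact: measurable_itv.
have D0 (r : R) : D r -> 0 <= r by rewrite /D/= in_itv/= => /andP[].
have mkD : measurable_fun D k.
  apply: measurable_funS mk.
    by apply: borel_lebesgue_measurable; exact: measurable_itv.
  by move=> r /D0 r0; rewrite /= in_itv/= r0.
have mrad := measurable_dist_to R d y.
pose nu : {measure set (lebesgue_R R) -> \bar R} :=
  measure_function_pushforward__canonical__measure_function_Measure mu mrad.
have mden E : measurable_fun (E : set (lebesgue_R R)) (radial_density R d).
  by apply: borel_lebesgue_measurable_fun; exact: measurable_radial_density.
rewrite -(@ge0_integral_pushforward _ _ _ (lebesgue_R R) R _ mrad mu D
  (EFin \o k))//; last 2 first.
- exact/measurable_EFinP.
- by move=> r /[!inE] /D0 r0; rewrite lee_fin k_ge0.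
rewrite (@ge0_integral_density _ (lebesgue_R R) R completed_lebesgue_measure
  nu D (radial_density R d))//.
- rewrite (eq_integral (fun r : lebesgue_R R =>
      (unit_ball_volume R d * d.+1%:R)%:E * (r ^+ d * k r)%:E)%E); last first.
    by move=> r _; rewrite /= /radial_density -!EFinM mulrC mulrA.
  rewrite ge0_integralZl//.
  + by rewrite kinfty// gt0_muley// lte_fin mulr_gt0 ?unit_ball_volume_gt0
      ?ltr0n.
  + apply/measurable_EFinP; apply: measurable_funM => //.
    by apply: borel_lebesgue_measurable_fun; exact: measurable_funX.
  + by move=> r /D0 r0; rewrite lee_fin mulr_ge0 ?exprn_ge0 ?k_ge0.
  + by rewrite lee_fin mulr_ge0// ltW// unit_ball_volume_gt0.
- by move=> r /D0; exact: radial_density_ge0.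
- move=> A mA AD; rewrite -(radial_measure R d y)// => r /AD /D0 r0.
  by rewrite /= in_itv/= r0.
- exact/measurable_EFinP.
- by move=> r /D0 r0; rewrite lee_fin k_ge0.
Qed.

Lemma not_ae_gt_on_ball (V : 'rV[R]_d.+1 -> R) :
  (\int[mu]_(y in setT) \int[mu]_(x in setT)
     (`|V x| * `|V y| * k (enorm (x - y)))%:E < +oo)%E ->
  forall (eps r : R) (x0 : 'rV[R]_d.+1), 0 < eps -> 0 < r ->
  ~ {ae mu, forall y, eball x0 r y -> eps < `|V y|}.
Proof.
move=> Vfin eps r x0 eps0 r0 [B [mB B0 VB]].
have epsV x : eball x0 r x -> ~ B x -> eps < `|V x|.
  by move=> xr nBx; apply: contrapT => nV; apply/nBx/VB => /(_ xr).
(* With |x - y| <= s and |y - x0| <= s, [enormD_le] gives |x - x0| <= 2 s = r / 2 < r. *)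
pose s := r / 4; have s0 : 0 < s by rewrite divr_gt0.
pose C := closed_eball R d x0 s `\` B.
have mC : measurable C by apply: measurableD => //;
  exact: measurable_closed_eball.
have C0 : mu C != 0%E.
  apply/eqP => muC0; have : (mu (closed_eball R d x0 s) <= mu C + mu B)%E.
    apply: (@le_trans _ _ (mu (C `|` B))); last exact: outer_measureU2.
    by apply: le_outer_measure => x; have [|] := pselect (B x); [right|left].
  rewrite muC0 [mu B]B0 adde0 lebesgue_measure_closed_eball; last exact: ltW.
  rewrite leNgt => /negP; apply.
  by rewrite lte_fin mulr_gt0 ?exprn_gt0 ?unit_ball_volume_gt0.
have near_x0 x y : C y -> dist_to R d y x <= s -> eball x0 r x.
  move=> [/= yx0 _] xy; rewrite /eball/= -(subrKA y).
  rewrite (le_lt_trans (enormD_le _ _ _ xy yx0))//.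
  by rewrite /s; lra.
have inner y : C y -> (\int[mu]_(x in setT)
    (`|V x| * `|V y| * k (enorm (x - y)))%:E = +oo)%E.
  move=> Cy; apply/eqP; rewrite -leye_eq.
  pose D : set (lebesgue_rV R d) := dist_to R d y @^-1` `[0, s]%classic.
  have mD : measurable D.
    rewrite -[X in measurable X]setTI; apply: measurable_dist_to => //.
    by apply: borel_lebesgue_measurable; exact: measurable_itv.
  have mkD E : measurable_fun E (EFin \o (k \o dist_to R d y)).
    by apply/measurable_EFinP/measurable_funTS; exact: measurable_radial_kernel.
  have k0 x : (0 <= (k (dist_to R d y x))%:E)%E
    by rewrite lee_fin k_ge0 ?enorm_ge0.
  (* Discarding the null set [B] keeps the integral infinite and leaves only points where |V|
     exceeds [eps]. *)
  have intDB : (\int[mu]_(x in D `\` B) (k (dist_to R d y x))%:E = +oo)%E.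
    by rewrite -(@ge0_negligible_integral _ _ _ mu D B)//
      ?integral_radial_kernel.
  have <- : (\int[mu]_(x in D `\` B)
      ((eps ^+ 2)%:E * (k (dist_to R d y x))%:E) = +oo)%E.
    rewrite ge0_integralZl//; [|exact: measurableD|by rewrite lee_fin sqr_ge0].
    by rewrite intDB gt0_muley// lte_fin exprn_gt0.
  rewrite integral_mkcond; apply: ge0_le_integral_setT => x; rewrite patchE;
    case: ifPn.
  - by move=> _; rewrite mule_ge0// lee_fin sqr_ge0.
  - by [].
  - rewrite inE => -[Dx nBx]; rewrite -EFinM lee_fin ler_wpM2r//.
      exact/k_ge0/enorm_ge0.
    rewrite expr2 ler_pM ?(ltW eps0)//; apply/ltW/epsV => //.
    + by apply: near_x0 Cy _; move: Dx; rewrite /D/= in_itv/= => /andP[].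
    + by apply: (le_lt_trans Cy.1); rewrite /s; lra.
    + by case: Cy.
  - by move=> _; rewrite lee_fin !mulr_ge0// k_ge0// enorm_ge0.
move: Vfin; rewrite ltNge leye_eq => /negP; apply; rewrite -leye_eq.
(* The inner integral is infinite on [C], which has positive measure, so the outer one dominates the
   integral of +oo over [C]. *)
have <- : (\int[mu]_(y in C) cst +oo y = +oo)%E.
  by rewrite integral_cst// gt0_mulye// lt0e C0 measure_ge0.
rewrite integral_mkcond; apply: ge0_le_integral_setT => y; rewrite patchE;
  case: ifPn => //.
- by move=> _; exact: le0y.
- by rewrite inE => Cy; rewrite inner.
- by move=> _; apply: integral_ge0 => x _;
    rewrite lee_fin !mulr_ge0// k_ge0// enorm_ge0.
Qed.

End divergence.

(** * The continuous case and the conclusion *)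

Lemma continuous_norm_gt_on_ball (R : realType) (n : nat) (V : 'rV[R]_n -> R)
    (x : 'rV[R]_n) :
  continuous V -> V x != 0 ->
  exists2 r : R, 0 < r & forall y, eball x r y -> `|V x| / 2 < `|V y|.
Proof.
move=> cV Vx; have e0 : 0 < `|V x| / 2 by rewrite divr_gt0// normr_gt0.
have /cvgr_dist_lt/(_ _ e0)/nbhs_ballP[r /= r0 xr] := cV x.
(* [ball] is the sup-norm ball, which contains the Euclidean ball of the same radius. *)
exists r => // y yr; have /xr/= : ball x r y.
  split => // i j; rewrite (ord1 i); apply: le_lt_trans yr.
  by have := normr_coord_le_enorm R (y - x) j; rewrite !mxE distrC.
have := ler_distD (V y) (V x) 0; rewrite !subr0 => h1 h2; lra.
Qed.

Theorem theorem3p9 (R : realType) (d : nat) (k : R -> R)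
    (k_ge0 : forall r : R, 0 <= r -> 0 <= k r)
    (mk : measurable_fun (`[0, +oo[ : set (lebesgue_R R)) k)
    (kinfty : forall delta : R, 0 < delta ->
      (\int[completed_lebesgue_measure]_(r in `[0%R, delta])
         (r ^+ d * k r)%:E = +oo)%E)
    (V : 'rV[R]_d.+1 -> R)
    (mV : measurable_fun [set: lebesgue_rV R d] V)
    (Vfin : (\int[@lebesgue_measure_rV R d]_(y in setT)
             \int[@lebesgue_measure_rV R d]_(x in setT)
               (`|V x| * `|V y| * k (enorm (x - y)))%:E < +oo)%E) :
  (forall (eps r : R) (x : 'rV[R]_d.+1), 0 < eps -> 0 < r ->
     ~ {ae @lebesgue_measure_rV R d,
          forall y, eball x r y -> eps < `|V y|}) /\
  (continuous V -> forall x, V x = 0).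
Proof.
have ball_contra := not_ae_gt_on_ball R d k k_ge0 mk kinfty V Vfin.
split=> [//|cV x]; apply: contrapT => /eqP Vx.
have [r r0 xr] := continuous_norm_gt_on_ball R d.+1 V x cV Vx.
apply: (ball_contra (`|V x| / 2) r x _ r0).
  by rewrite divr_gt0// normr_gt0.
exact: aeW.
Qed.
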